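(* The variety $\mathcal K$ is a subvariety of $\mathcal M$.
   Context: An additively idempotent semiring (ai-semiring) is an algebra $(S,+,\cdot)$ of signature $(2,2)$, without constants, such that $(S,+)$ is a commutative idempotent semigroup, $(S,\cdot)$ is a semigroup, and multiplication distributes over addition. It is commutative if its multiplication is commutative. All varieties are in the signature $(2,2)$. $\mathbf N$ is the ai-semiring on the nonnegative integers $\mathbb N_0$ whose semiring addition is $\max$ and whose semiring multiplication is numerical addition; $\mathcal M=\mathsf V(\mathbf N)$ is the variety it generates. $\mathcal K$ is the variety of commutative ai-semirings defined by the three identities $xy+x\approx xy$, $x^2+y^2+xy\approx x^2+y^2$, and $x_1x_2+x_2x_3+x_3x_4\approx x_1x_2+x_2x_3+x_3x_4+x_1x_4$. *)

(* Defs.v *)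
From Stdlib Require Import ClassicalEpsilon.
From mathcomp Require Import all_boot.

Set Implicit Arguments.
Unset Strict Implicit.
Unset Printing Implicit Defensive.

Declare Scope alg_scope.
Delimit Scope alg_scope with alg.

(* Algebras of signature (2,2), with nonempty carrier and no constants. *)
Record algebra := Algebra {
  carrier :> Type;
  add : carrier -> carrier -> carrier;
  mul : carrier -> carrier -> carrier;
  carrier_inhabited : inhabited carrier
}.

Notation "x + y" := (add x y) : alg_scope.
Notation "x * y" := (mul x y) : alg_scope.

Section Identities.
Local Open Scope alg_scope.

Record ai_semiring (A : algebra) : Prop := AiSemiring {
  ai_addA : forall x y z : A, x + (y + z) = (x + y) + z;
  ai_addC : forall x y : A, x + y = y + x;
  ai_addxx : forall x : A, x + x = x;
  ai_mulA : forall x y z : A, x * (y * z) = (x * y) * z;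
  ai_mulDl : forall x y z : A, (x + y) * z = x * z + y * z;
  ai_mulDr : forall x y z : A, x * (y + z) = x * y + x * z
}.

Definition mul_commutative (A : algebra) : Prop :=
  forall x y : A, x * y = y * x.

Record variety_K (A : algebra) : Prop := VarietyK {
  K_ai_semiring : ai_semiring A;
  K_mulC : mul_commutative A;
  K_absorb : forall x y : A, x * y + x = x * y;
  K_square : forall x y : A, x * x + y * y + x * y = x * x + y * y;
  K_path : forall x1 x2 x3 x4 : A,
    x1 * x2 + x2 * x3 + x3 * x4 = x1 * x2 + x2 * x3 + x3 * x4 + x1 * x4
}.

Record hom (A B : algebra) (f : A -> B) : Prop := Hom {
  hom_add : forall x y : A, f (x + y) = f x + f y;
  hom_mul : forall x y : A, f (x * y) = f x * f y
}.

End Identities.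

Definition prod_algebra (I : Type) (A : I -> algebra) : algebra :=
  {| carrier := forall i, A i;
     add := fun f g i => add (f i) (g i);
     mul := fun f g i => mul (f i) (g i);
     carrier_inhabited :=
       inhabits (fun i => epsilon (carrier_inhabited (A i)) (fun _ => True)) |}.

Definition closed_images (V : algebra -> Prop) : Prop :=
  forall (A B : algebra) (f : A -> B),
    hom f -> (forall y : B, exists x : A, f x = y) -> V A -> V B.

(* Subalgebras are taken up to isomorphism, i.e. as embeddings. *)
Definition closed_subalgebras (V : algebra -> Prop) : Prop :=
  forall (A B : algebra) (f : B -> A), hom f -> injective f -> V A -> V B.

(* The index type may be empty, so a variety contains the trivial algebra. *)
Definition closed_products (V : algebra -> Prop) : Prop :=
  forall (I : Type) (A : I -> algebra),
    (forall i, V (A i)) -> V (prod_algebra A).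

Record variety (V : algebra -> Prop) : Prop := Variety {
  variety_images : closed_images V;
  variety_subalgebras : closed_subalgebras V;
  variety_products : closed_products V
}.

Definition generated_variety (A : algebra) : algebra -> Prop :=
  fun B => forall V : algebra -> Prop, variety V -> V A -> V B.

Definition subvariety (V W : algebra -> Prop) : Prop :=
  variety V /\ forall A : algebra, V A -> W A.

Definition algebra_N : algebra :=
  {| carrier := nat; add := maxn; mul := addn; carrier_inhabited := inhabits 0 |}.

Definition variety_M : algebra -> Prop := generated_variety algebra_N.

(* Main.v *)
From Stdlib Require Import ClassicalEpsilon FunctionalExtensionality.
From Stdlib Require Import ProofIrrelevance.
From mathcomp Require Import all_boot.
Require Import Defs.

Set Implicit Arguments.
Unset Strict Implicit.
Unset Printing Implicit Defensive.

(** K is defined by identities, so it is closed under images, subalgebras and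
    products; the content of the theorem is that every identity s = t of N
    holds in every A in K, since by the usual argument of Birkhoff an algebra
    that satisfies the identities of N is an image of a subalgebra of a power
    of N ([generated_variety_of_identities]).

    An identity splits into two inequalities for the order x + y = y.  A term is
    the sum of its words, so it suffices to show that a word w lies below the
    value S of s in A as soon as w is below s under all assignments of natural
    numbers.  Regard a and b as adjacent when ab <= S.  The path law says that
    a walk of length three from a to b makes a and b adjacent, hence so does
    every walk of odd length; the square law makes a and b adjacent as soon as
    both carry a loop.  Moreover any product of at least three elements is
    idempotent in A ([mul3_idem]), so that a long word below S makes all its
    letters adjacent to each other and to themselves.  Consequently:

    - a letter x is below S when it occurs in s;
    - xy is below S when x and y are adjacent or both carry a loop;
    - a word of length at least three is below S when s has a long word
      and all letters of w carry loops.

    When one of these conditions fails, an explicit assignment shows that w is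
    not below s in N.  The main one exploits that a vertex x without a loop lies
    in a bipartite component: it gives a large number L to the letters on the
    side of x and at most 1 to all other letters.  No two letters on that side
    are adjacent and none occurs in a long word, so the words of s have value
    about L, while w exceeds that. *)

Local Open Scope alg_scope.

(** * Terms and the varieties that their identities define *)

Inductive term (X : Type) : Type :=
| Var of X
| Add of term X & term X
| Mul of term X & term X.

Arguments Var {X} _.

Fixpoint eval (X : Type) (A : algebra) (v : X -> A) (t : term X) : A :=
  match t with
  | Var x => v x
  | Add s t => eval v s + eval v t
  | Mul s t => eval v s * eval v t
  end.

(** The term functions over A form a subalgebra of the power of B indexed by
    the assignments A -> B, and evaluation at the identity assignment maps it
    onto A; the hypothesis says that this map is well defined. *)
Lemma generated_variety_of_identities (A B : algebra) :
  (forall s t : term A,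
     (forall v : A -> B, eval v s = eval v t) -> eval id s = eval id t) ->
  generated_variety B A.
Proof.
move=> idAB V [Vimg Vsub Vprod] VB.
pose P := prod_algebra (fun _ : A -> B => B).
pose is_term (f : P) := exists t : term A, forall v, f v = eval v t.
have is_term_add (f g : P) : is_term f -> is_term g -> is_term (f + g).
  by move=> [s fs] [t gt]; exists (Add s t) => v /=; rewrite fs gt.
have is_term_mul (f g : P) : is_term f -> is_term g -> is_term (f * g).
  by move=> [s fs] [t gt]; exists (Mul s t) => v /=; rewrite fs gt.
have is_term_var a : is_term (fun v => v a) by exists (Var a).
have inhD : inhabited {f : P | is_term f}.
  by have [a] := carrier_inhabited A; exact: inhabits (exist _ _ (is_term_var a)).
pose D := @Algebra {f : P | is_term f}
  (fun f g => exist _ _ (is_term_add _ _ (proj2_sig f) (proj2_sig g)))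
  (fun f g => exist _ _ (is_term_mul _ _ (proj2_sig f) (proj2_sig g))) inhD.
have VD : V D.
  apply: (Vsub P D (fun f => proj1_sig f)); [by split | | exact: Vprod].
  by move=> [f ff] [g gg] /= fg; subst g; rewrite (proof_irrelevance _ ff gg).
pose term_of (f : D) : {t : term A | forall v, proj1_sig f v = eval v t} :=
  constructive_indefinite_description _ (proj2_sig f).
pose h (f : D) : A := eval id (proj1_sig (term_of f)).
have hE (f : D) t : (forall v, proj1_sig f v = eval v t) -> h f = eval id t.
  move=> ft; apply: idAB => v.
  by rewrite -(proj2_sig (term_of f)).
apply: (Vimg D A h) VD.
  split=> f g; have ft := proj2_sig (term_of f); have gt := proj2_sig (term_of g).
    by rewrite (hE _ (Add (proj1_sig (term_of f)) (proj1_sig (term_of g)))) // => v;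
      rewrite /= ft gt.
  by rewrite (hE _ (Mul (proj1_sig (term_of f)) (proj1_sig (term_of g)))) // => v;
    rewrite /= ft gt.
by move=> a; exists (exist _ _ (is_term_var a)); rewrite (hE _ (Var a)).
Qed.

(** * Closure properties of K *)

Lemma variety_K_images : closed_images variety_K.
Proof.
move=> A B f [fD fM] fsurj [[addA addC addxx mulA mulDl mulDr] mulC absorb square path].
split; [split | ..].
- move=> x y z; have [[x' <-] [y' <-] [z' <-]] := And3 (fsurj x) (fsurj y) (fsurj z).
  by rewrite -!(fM, fD) addA.
- move=> x y; have [[x' <-] [y' <-]] := conj (fsurj x) (fsurj y).
  by rewrite -!(fM, fD) addC.
- by move=> x; have [x' <-] := fsurj x; rewrite -!(fM, fD) addxx.
- move=> x y z; have [[x' <-] [y' <-] [z' <-]] := And3 (fsurj x) (fsurj y) (fsurj z).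
  by rewrite -!(fM, fD) mulA.
- move=> x y z; have [[x' <-] [y' <-] [z' <-]] := And3 (fsurj x) (fsurj y) (fsurj z).
  by rewrite -!(fM, fD) mulDl.
- move=> x y z; have [[x' <-] [y' <-] [z' <-]] := And3 (fsurj x) (fsurj y) (fsurj z).
  by rewrite -!(fM, fD) mulDr.
- move=> x y; have [[x' <-] [y' <-]] := conj (fsurj x) (fsurj y).
  by rewrite -!(fM, fD) mulC.
- move=> x y; have [[x' <-] [y' <-]] := conj (fsurj x) (fsurj y).
  by rewrite -!(fM, fD) absorb.
- move=> x y; have [[x' <-] [y' <-]] := conj (fsurj x) (fsurj y).
  by rewrite -!(fM, fD) square.
- move=> x y z t.
  have [[x' <-] [y' <-] [z' <-] [t' <-]] :=
    And4 (fsurj x) (fsurj y) (fsurj z) (fsurj t).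
  by rewrite -!(fM, fD) -path.
Qed.

Lemma variety_K_subalgebras : closed_subalgebras variety_K.
Proof.
move=> A B f [fD fM] finj [[addA addC addxx mulA mulDl mulDr] mulC absorb square path].
split; [split | ..].
- by move=> x y z; apply: finj; rewrite !(fM, fD) addA.
- by move=> x y; apply: finj; rewrite !(fM, fD) addC.
- by move=> x; apply: finj; rewrite !(fM, fD) addxx.
- by move=> x y z; apply: finj; rewrite !(fM, fD) mulA.
- by move=> x y z; apply: finj; rewrite !(fM, fD) mulDl.
- by move=> x y z; apply: finj; rewrite !(fM, fD) mulDr.
- by move=> x y; apply: finj; rewrite !(fM, fD) mulC.
- by move=> x y; apply: finj; rewrite !(fM, fD) absorb.
- by move=> x y; apply: finj; rewrite !(fM, fD) square.
- by move=> x y z t; apply: finj; rewrite !(fM, fD) -path.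
Qed.

Lemma variety_K_products : closed_products variety_K.
Proof.
move=> I A KA; have SA i := K_ai_semiring (KA i).
split; [split | ..].
- by move=> x y z; apply: functional_extensionality_dep => i; apply: (ai_addA (SA i)).
- by move=> x y; apply: functional_extensionality_dep => i; apply: (ai_addC (SA i)).
- by move=> x; apply: functional_extensionality_dep => i; apply: (ai_addxx (SA i)).
- by move=> x y z; apply: functional_extensionality_dep => i; apply: (ai_mulA (SA i)).
- by move=> x y z; apply: functional_extensionality_dep => i; apply: (ai_mulDl (SA i)).
- by move=> x y z; apply: functional_extensionality_dep => i; apply: (ai_mulDr (SA i)).
- by move=> x y; apply: functional_extensionality_dep => i; apply: (K_mulC (KA i)).
- by move=> x y; apply: functional_extensionality_dep => i; apply: (K_absorb (KA i)).
- by move=> x y; apply: functional_extensionality_dep => i; apply: (K_square (KA i)).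
- move=> x1 x2 x3 x4; apply: functional_extensionality_dep => i.
  exact: (K_path (KA i)).
Qed.

(** * Words of a term and the order of an ai-semiring *)

Inductive word (X : Type) : Type :=
| Letter of X
| Cons of X & word X.

Fixpoint word_cat (X : Type) (u v : word X) : word X :=
  match u with
  | Letter x => Cons x v
  | Cons x u' => Cons x (word_cat u' v)
  end.

Fixpoint occurs (X : Type) (z : X) (w : word X) : Prop :=
  match w with
  | Letter x => z = x
  | Cons x w' => z = x \/ occurs z w'
  end.

Fixpoint word_eval (X : Type) (A : algebra) (v : X -> A) (w : word X) : A :=
  match w with
  | Letter x => v x
  | Cons x w' => v x * word_eval v w'
  end.

Fixpoint word_of (X : Type) (t : term X) (w : word X) : Prop :=
  match t with
  | Var x => w = Letter x
  | Add t1 t2 => word_of t1 w \/ word_of t2 w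
  | Mul t1 t2 =>
      exists w1 w2, [/\ word_of t1 w1, word_of t2 w2 & w = word_cat w1 w2]
  end.

Definition ale (A : algebra) (x y : A) : Prop := x + y = y.

Notation "x <= y" := (ale x y) : alg_scope.

Section AiSemiring.
Variables (A : algebra) (SA : ai_semiring A).

Lemma ale_refl (x : A) : x <= x.
Proof. exact: ai_addxx. Qed.

Lemma ale_trans (y x z : A) : x <= y -> y <= z -> x <= z.
Proof. by rewrite /ale => xy yz; rewrite -yz (ai_addA SA) xy. Qed.

Lemma ale_anti (x y : A) : x <= y -> y <= x -> x = y.
Proof. by rewrite /ale => xy yx; rewrite -xy (ai_addC SA) yx. Qed.

Lemma ale_addl (x y : A) : x <= x + y.
Proof. by rewrite /ale (ai_addA SA) (ai_addxx SA). Qed.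

Lemma ale_addr (x y : A) : y <= x + y.
Proof. by rewrite (ai_addC SA); apply: ale_addl. Qed.

Lemma ale_add_lub (x y z : A) : x <= z -> y <= z -> x + y <= z.
Proof. by rewrite /ale => xz yz; rewrite -(ai_addA SA) yz. Qed.

Lemma ale_mul (x y z t : A) : x <= y -> z <= t -> x * z <= y * t.
Proof.
rewrite /ale => xy zt; apply: (ale_trans (y := y * z)).
  by rewrite /ale -(ai_mulDl SA) xy.
by rewrite /ale -(ai_mulDr SA) zt.
Qed.

Lemma word_eval_cat (X : Type) (v : X -> A) (w1 w2 : word X) :
  word_eval v (word_cat w1 w2) = word_eval v w1 * word_eval v w2.
Proof. by elim: w1 => [//|x w1 IH] /=; rewrite IH (ai_mulA SA). Qed.

(** A term is the distributive sum of its words.  The additive map f lets the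
    induction go through products, where it absorbs the other factor. *)
Lemma eval_le_additive (X : Type) (v : X -> A) (t : term X) (f : A -> A) (c : A) :
  (forall x y, f (x + y) = f x + f y) ->
  f (eval v t) <= c <-> (forall w, word_of t w -> f (word_eval v w) <= c).
Proof.
elim: t f c => [x|t1 IH1 t2 IH2|t1 IH1 t2 IH2] f c fD /=.
- by split=> [le_c w -> //|/(_ _ erefl)].
- rewrite fD; split=> [le_c w [w1|w2]|le_c].
  + by move: w w1; apply/(IH1 _ _ fD); apply: ale_trans le_c; apply: ale_addl.
  + by move: w w2; apply/(IH2 _ _ fD); apply: ale_trans le_c; apply: ale_addr.
  + by apply: ale_add_lub; [apply/IH1 | apply/IH2] => // w ww; apply: le_c; auto.
- have f1D y z : f ((y + z) * eval v t2) = f (y * eval v t2) + f (z * eval v t2).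
    by rewrite (ai_mulDl SA) fD.
  have f2D w1 y z :
      f (word_eval v w1 * (y + z)) = f (word_eval v w1 * y) + f (word_eval v w1 * z).
    by rewrite (ai_mulDr SA) fD.
  have IH1' := IH1 (fun y => f (y * eval v t2)) c f1D.
  have IH2' w1 := IH2 (fun y => f (word_eval v w1 * y)) c (f2D w1).
  split=> [le_c w [w1 [w2 [ww1 ww2 ->]]]|le_c].
    by rewrite word_eval_cat; apply: (proj1 (IH2' w1)) => //; apply: (proj1 IH1').
  apply/IH1' => w1 ww1; apply/(IH2' w1) => w2 ww2.
  by rewrite -word_eval_cat; apply: le_c; exists w1, w2.
Qed.

Lemma eval_le (X : Type) (v : X -> A) (t : term X) (c : A) :
  eval v t <= c <-> (forall w, word_of t w -> word_eval v w <= c).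
Proof. exact: (eval_le_additive v t (f := id)). Qed.

Lemma word_le_eval (X : Type) (v : X -> A) (t : term X) (w : word X) :
  word_of t w -> word_eval v w <= eval v t.
Proof. by apply: (proj1 (eval_le v t _)); apply: ale_refl. Qed.

End AiSemiring.

Lemma algebra_N_ai_semiring : ai_semiring algebra_N.
Proof.
split=> /=.
- exact: maxnA.
- exact: maxnC.
- exact: maxnn.
- exact: addnA.
- exact: addn_maxl.
- exact: addn_maxr.
Qed.

Lemma ale_N (m n : algebra_N) : m <= n <-> (m <= n)%N.
Proof. exact: (rwP maxn_idPr). Qed.

Lemma word_eval_N_mono (X : Type) (v v' : X -> algebra_N) (w : word X) :
  (forall z, occurs z w -> (v z <= v' z)%N) ->
  (word_eval v w <= word_eval v' w)%N.
Proof.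
elim: w => [x|x w IH] /= le_v; first exact: le_v.
by apply: leq_add; [apply: le_v; left | apply: IH => z zw; apply: le_v; right].
Qed.

Lemma word_eval_N_gt0 (X : Type) (v : X -> algebra_N) (w : word X) :
  (forall z, (0 < v z)%N) -> (0 < word_eval v w)%N.
Proof. by move=> v_gt0; elim: w => //= x w _; rewrite addn_gt0 v_gt0. Qed.

Lemma word_eval_N_occurs (X : Type) (v : X -> algebra_N) (x : X) (w : word X) :
  occurs x w -> (v x <= word_eval v w)%N.
Proof.
elim: w => [y -> //|y w IH [->|/IH xw]] /=; first exact: leq_addr.
exact: leq_trans xw (leq_addl _ _).
Qed.

Lemma word_eval_N_long (X : Type) (v : X -> algebra_N) (x y z : X) (w : word X) :
  (forall z, (0 < v z)%N) -> occurs x (Cons y (Cons z w)) ->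
  (v x + 2 <= word_eval v (Cons y (Cons z w)))%N.
Proof.
move=> v_gt0 /=; have w_gt0 := word_eval_N_gt0 w v_gt0.
case=> [->|[->|/(word_eval_N_occurs v) xw]].
- by rewrite leq_add2l (leq_add (v_gt0 z) w_gt0).
- by rewrite addnCA leq_add2l (leq_add (v_gt0 y) w_gt0).
- by rewrite addnA addnC leq_add // (leq_add (v_gt0 y) (v_gt0 z)).
Qed.

Lemma word_eval_N0 (X : Type) (w : word X) :
  word_eval (fun _ : X => (0%N : algebra_N)) w = 0%N.
Proof. by elim: w => //= x w ->. Qed.

(** * Arithmetic in K *)

Section VarietyK.
Variables (A : algebra) (KA : variety_K A).

Let SA : ai_semiring A := K_ai_semiring KA.
Let mulC : commutative (@mul A) := K_mulC KA.
Let mulA : associative (@mul A) := ai_mulA SA.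

Let mulCA (x y z : A) : x * (y * z) = y * (x * z).
Proof. by rewrite mulA (mulC x) mulA. Qed.

Let mulACA (x y z t : A) : (x * y) * (z * t) = (x * z) * (y * t).
Proof. by rewrite -!mulA (mulCA y). Qed.

Lemma ale_mulr (x y : A) : x <= x * y.
Proof. by rewrite /ale (ai_addC SA) (K_absorb KA). Qed.

Lemma ale_mull (x y : A) : y <= x * y.
Proof. by rewrite mulC; apply: ale_mulr. Qed.

Lemma ale_path (x1 x2 x3 x4 c : A) :
  x1 * x2 <= c -> x2 * x3 <= c -> x3 * x4 <= c -> x1 * x4 <= c.
Proof.
move=> c12 c23 c34; apply: (ale_trans SA (y := x1 * x2 + x2 * x3 + x3 * x4)).
  by rewrite (K_path KA); apply: ale_addr.
by do ?apply: ale_add_lub.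
Qed.

Lemma ale_square (x y c : A) : x * x <= c -> y * y <= c -> x * y <= c.
Proof.
move=> cx cy; apply: (ale_trans SA (y := x * x + y * y)); last exact: ale_add_lub.
by rewrite -(K_square KA); apply: ale_addr.
Qed.

(** Two uses of the path law: the walk yz, x, y, xz gives yzxz <= xyz, and
    the walk xyz, z, z, xyz gives (xyz)(xyz) <= xyzz. *)
Lemma mul3_idem (x y z : A) : (x * (y * z)) * (x * (y * z)) = x * (y * z).
Proof.
apply: (ale_anti SA); last exact: ale_mulr.
apply: (ale_trans SA (y := (y * z) * (x * z))).
  apply: (@ale_path _ z z).
  - by rewrite (mulC x) -(mulA (y * z)); apply: (ale_refl SA).
  - by rewrite mulACA; apply: ale_mull.
  - by rewrite mulC (mulC x) -(mulA (y * z)); apply: (ale_refl SA).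
apply: (@ale_path _ x y).
- by rewrite mulC; apply: (ale_refl SA).
- by rewrite mulA; apply: ale_mulr.
- by rewrite mulCA; apply: (ale_refl SA).
Qed.

End VarietyK.

(** * Identities of N in a member of K *)

(** Truth values as numbers, to define assignments by cases on propositions. *)
Definition indic (P : Prop) : nat := excluded_middle_informative P : bool.

Lemma indicT (P : Prop) : P -> indic P = 1%N.
Proof. by rewrite /indic; case: excluded_middle_informative. Qed.

Lemma indicF (P : Prop) : ~ P -> indic P = 0%N.
Proof. by rewrite /indic; case: excluded_middle_informative. Qed.

Lemma indic_le1 (P : Prop) : (indic P <= 1)%N.
Proof. exact: leq_b1. Qed.

Section Comparison.
Variables (A : algebra) (KA : variety_K A).

Let SA : ai_semiring A := K_ai_semiring KA.
Let mulC : commutative (@mul A) := K_mulC KA.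

(** The elements reached from x by a walk of length zero or two in the graph
    where a and b are adjacent if a * b <= c; by the path law longer walks of
    even length reach nothing more. *)
Definition side (c x z : A) : Prop :=
  z = x \/ exists y, x * y <= c /\ y * z <= c.

Lemma side_adj (c x a b : A) : side c x a -> a * b <= c -> x * b <= c.
Proof. by case=> [-> //|[y [xy ya]]] ab; apply: (ale_path KA) xy ya ab. Qed.

(** Otherwise the odd closed walk x, a, y, x would put a loop on x. *)
Lemma side_not_adj (c x a : A) : ~ x * x <= c -> side c x a -> ~ x * a <= c.
Proof.
move=> no_loop [-> //|[y [xy ya]]] xa; apply: no_loop.
by apply: (ale_path KA) xa (_ : a * y <= c) _; rewrite mulC.
Qed.

Section Words.
Variables (X : Type) (phi : X -> A).

Lemma occurs_le (z : X) (w : word X) : occurs z w -> phi z <= word_eval phi w.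
Proof.
elim: w => [x ->|x w IH [->|/IH zw]] /=; first exact: (ale_refl SA).
  exact: (ale_mulr KA).
exact: (ale_trans SA zw (ale_mull KA _ _)).
Qed.

Lemma long_word_adj (x y a b : X) (w : word X) :
  let u := Cons x (Cons y w) in
  occurs a u -> occurs b u -> phi a * phi b <= word_eval phi u.
Proof.
move=> u au bu; rewrite /= -(mul3_idem KA).
exact: (ale_mul SA (occurs_le au) (occurs_le bu)).
Qed.

(** Path law along x, e, e, w e, starting from the square law for x and e. *)
Lemma word_mul_idem_le (e c : A) (w : word X) :
  e * e = e -> e <= c -> (forall x, occurs x w -> phi x * phi x <= c) ->
  word_eval phi w * e <= c.
Proof.
move=> ee ec; have ec2 : e * e <= c by rewrite ee.
elim: w => [x|x w IH] /= loops; first by apply: (ale_square KA) => //; apply: loops.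
have xe : phi x * e <= c by apply: (ale_square KA) => //; apply: loops; left.
rewrite -(ai_mulA SA); apply: (ale_path KA xe ec2).
rewrite mulC -(ai_mulA SA) ee; apply: IH => z zw; by apply: loops; right.
Qed.

Variable s : term X.

Let S : A := eval phi s.
(* Bounds the length of every word of s, hence its value when all letters are
   at most 1; the summand 2 makes this bound hold for all words of length two. *)
Let L : nat := (eval (fun _ : X => (1%N : algebra_N)) s + 2)%N.

Let v (x : X) (e : X -> nat) (z : X) : nat :=
  if excluded_middle_informative (side S (phi x) (phi z)) then L else e z.

Let v_side x e z : side S (phi x) (phi z) -> v x e z = L.
Proof. by rewrite /v; case: excluded_middle_informative. Qed.

Let v_other x e z : ~ side S (phi x) (phi z) -> v x e z = e z.
Proof. by rewrite /v; case: excluded_middle_informative. Qed.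

Let v_self x e : v x e x = L.
Proof. by apply: v_side; left. Qed.

(** In a word of length two with a letter on the side of x, the other letter is
    on the opposite side, where e is at most m; a long word has no letter on
    the side of x. *)
Lemma side_assignment_bound (x : X) (e : X -> nat) (m : nat) (u : word X) :
  ~ phi x * phi x <= S ->
  (forall z, (e z <= 1)%N) ->
  (forall z, phi x * phi z <= S -> (e z <= m)%N) ->
  word_of s u -> (word_eval (v x e : X -> algebra_N) u <= L + m)%N.
Proof.
move=> no_loop e1 em su; have uS := word_le_eval SA phi su.
have L2 : (2 <= L)%N by rewrite leq_addl.
have opposite a b : side S (phi x) (phi a) -> phi a * phi b <= S ->
    (v x e a + v x e b <= L + m)%N.
  move=> xa ab; have xb := side_adj xa ab.
  rewrite v_side // v_other; first by rewrite leq_add2l em.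
  by move=> /(side_not_adj no_loop).
case: u su uS => [a|a [b|b u]] su uS.
- rewrite /= (leq_trans _ (leq_addr _ _)) // /v.
  by case: excluded_middle_informative => /= // _; apply: leq_trans (e1 a) (ltnW L2).
- move: uS => /= ab.
  case: (excluded_middle_informative (side S (phi x) (phi a))) => xa.
    exact: opposite.
  case: (excluded_middle_informative (side S (phi x) (phi b))) => xb.
    by rewrite addnC; apply: opposite => //; rewrite mulC.
  rewrite !v_other // (leq_trans _ (leq_addr _ _)) // (leq_trans _ L2) //.
  exact: leq_add (e1 a) (e1 b).
- apply: leq_trans (leq_addr _ _); apply: leq_trans (leq_addr _ _).
  apply: leq_trans (proj1 (ale_N _ _) (word_le_eval algebra_N_ai_semiring _ su)).
  apply: word_eval_N_mono => z zu; rewrite v_other // => xz.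
  have zz := ale_trans SA (long_word_adj zu zu) uS.
  exact: (side_not_adj no_loop xz (side_adj xz zz)).
Qed.

Variable w : word X.
Hypothesis w_le_s :
  forall f : X -> algebra_N, (word_eval f w <= eval f s)%N.

Let w_bound (f : X -> algebra_N) (c : nat) :
  (forall u, word_of s u -> (word_eval f u <= c)%N) -> (word_eval f w <= c)%N.
Proof.
move=> le_c; apply: leq_trans (w_le_s f) _; apply/ale_N.
by apply/(eval_le algebra_N_ai_semiring) => u su; apply/ale_N/le_c.
Qed.

Let letter_le (x : X) : w = Letter x -> phi x <= S.
Proof.
move=> wx; case: (excluded_middle_informative (phi x <= S)) => // not_le.
pose f z : algebra_N := indic (phi z = phi x).
have : (word_eval f w <= 0)%N.
  apply: w_bound => u su; rewrite -(word_eval_N0 u); apply: word_eval_N_mono => z zu.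
  rewrite /f indicF // => zx; apply: not_le; rewrite -zx.
  exact: (ale_trans SA (occurs_le zu) (word_le_eval SA phi su)).
by rewrite wx /= /f indicT.
Qed.

(** If x has no loop then the assignment L on the side of x, 0 on the opposite
    side and 1 elsewhere separates xy from s, unless x and y are adjacent: y has
    a positive value, while no word of s exceeds L. *)
Let adj_or_loop (x y : X) :
  (forall f : X -> algebra_N, word_eval f w = (f x + f y)%N) ->
  phi x * phi y <= S \/ phi x * phi x <= S.
Proof.
move=> wxy.
case: (excluded_middle_informative (phi x * phi y <= S)) => [|not_adj]; first by left.
case: (excluded_middle_informative (phi x * phi x <= S)) => [|no_loop]; first by right.
pose e z := indic (~ phi x * phi z <= S).
have : (word_eval (v x e : X -> algebra_N) w <= L + 0)%N.
  apply: w_bound => u; apply: side_assignment_bound => // z; first exact: indic_le1.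
  by move=> xz; rewrite /e indicF.
rewrite wxy v_self leq_add2l leqn0 => /eqP.
rewrite /v; case: excluded_middle_informative => /= _.
  by rewrite /L addn2.
by rewrite /e indicT.
Qed.

Let pair_le (x y : X) :
  (forall f : X -> algebra_N, word_eval f w = (f x + f y)%N) ->
  phi x * phi y <= S.
Proof.
move=> wxy; case: (adj_or_loop wxy) => // xx.
case: (@adj_or_loop y x) => [f|yx|yy]; first by rewrite wxy addnC.
  by rewrite mulC.
exact: (ale_square KA).
Qed.

(** Were all words of s of length at most two, the constant assignment 1 would
    separate a long word from s; were x without a loop, the assignment L on the
    side of x and 1 elsewhere would. *)
Let long_le (a b : X) (w' : word X) :
  w = Cons a (Cons b w') -> word_eval phi w <= S.
Proof.
move=> wE.
have [a' [b' [u su]]] : exists a' b' u, word_of s (Cons a' (Cons b' u)).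
  apply: NNPP => no_long.
  have : (word_eval (fun=> 1%N : algebra_N) w <= 2)%N.
    apply: w_bound => -[c|c [d|d u]] su //.
    by case: no_long; exists c, d, u.
  by rewrite wE /= !add1n !ltnS leqNgt word_eval_N_gt0.
have loops x : occurs x w -> phi x * phi x <= S.
  move=> xw; apply: NNPP => no_loop.
  have : (word_eval (v x (fun=> 1%N) : X -> algebra_N) w <= L + 1)%N.
    by apply: w_bound => u'; apply: side_assignment_bound.
  have v_gt0 z : (0 < v x (fun=> 1%N) z)%N.
    by rewrite /v; case: excluded_middle_informative => /= _; rewrite // /L addn2.
  rewrite wE in xw *; have := word_eval_N_long v_gt0 xw.
  rewrite v_self => le1 le2; have := leq_trans le1 le2.
  by rewrite leq_add2l.
set e := word_eval phi (Cons a' (Cons b' u)).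
apply: (ale_trans SA (ale_mulr KA _ e)).
apply: word_mul_idem_le => //; first exact: (mul3_idem KA).
exact: (word_le_eval SA phi su).
Qed.

Lemma word_le_of_N : word_eval phi w <= S.
Proof.
case wE : w => [x|x [y|y w']].
- exact: letter_le.
- by apply: pair_le => f; rewrite wE.
- by rewrite -wE; apply: long_le wE.
Qed.

End Words.

Lemma eval_le_of_N (X : Type) (phi : X -> A) (s t : term X) :
  (forall v : X -> algebra_N, (eval v t <= eval v s)%N) ->
  eval phi t <= eval phi s.
Proof.
move=> ts; apply/(eval_le SA) => w tw; apply: word_le_of_N => v.
apply: leq_trans (ts v); apply/ale_N.
exact: (word_le_eval algebra_N_ai_semiring v tw).
Qed.

End Comparison.

Theorem proposition5p1 : subvariety variety_K variety_M.
Proof.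
split.
  split; [exact: variety_K_images | exact: variety_K_subalgebras
         | exact: variety_K_products].
move=> A KA; apply: generated_variety_of_identities => s t st.
by apply: (ale_anti (K_ai_semiring KA));
  apply: (eval_le_of_N KA) => v; rewrite st.
Qed.
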